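(* Let $q\ge 2$ be an integer, $s\in(0,2)$, and let $P(x,t)=|\Psi(x,t)|^2$ be as in the context. Then for Lebesgue-almost every $x\in[0,\pi]$ the graph of $t\mapsto P(x,t)$ over any compact interval $[a,b]$ with $a<b$ has box-counting dimension $D_t=1+s/2$.
   Context: For an integer $q\ge2$ and $s\in(0,2)$ define, for $x\in[0,\pi]$ and $t\in\mathbb R$, $$\Psi(x,t)=N\sum_{n=0}^{\infty} q^{n(s-2)}\sin(q^n x)\,e^{-i q^{2n} t},\qquad N=\sqrt{\tfrac{2}{\pi}\big(1-q^{2(s-2)}\big)},$$ a uniformly convergent series. Let $P(x,t)=|\Psi(x,t)|^2$. For a bounded set $A\subset\mathbb R^d$ let $N(\delta)$ be the number of cubes $[m_1\delta,(m_1+1)\delta]\times\dots\times[m_d\delta,(m_d+1)\delta]$, $m_i\in\mathbb Z$, meeting $A$. The upper and lower box-counting dimensions are $\limsup_{\delta\to0}$ and $\liminf_{\delta\to0}$ of $\ln N(\delta)/\ln(1/\delta)$. The box-counting dimension exists when these two coincide, and is then their common value. *)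

(* Defs.v *)
From HB Require Import structures.
From mathcomp Require Import all_boot all_order all_algebra.
From mathcomp Require Import finmap.
From mathcomp Require Import all_classical all_reals all_analysis.
Set Implicit Arguments. Unset Strict Implicit. Unset Printing Implicit Defensive.
Import Order.TTheory GRing.Theory Num.Theory.
Import numFieldNormedType.Exports.
Local Open Scope classical_set_scope.
Local Open Scope ring_scope.

Section Defs.
Variable R : realType.

Definition Nconst (q : nat) (s : R) : R :=
  Num.sqrt (2 / pi * (1 - q%:R `^ (2 * (s - 2)))).

Definition coef (q : nat) (s : R) (n : nat) : R := q%:R `^ (n%:R * (s - 2)).

(* Psi(x,t) = N sum_n q^(n(s-2)) sin(q^n x) e^{-i q^(2n) t}, split into real
   and imaginary parts: e^{-i th} = cos th - i sin th. *)
Definition RePsi (q : nat) (s x t : R) : R :=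
  Nconst q s * limn (series (fun n : nat =>
    coef q s n * sin (q%:R ^+ n * x) * cos (q%:R ^+ (2 * n) * t))).

Definition ImPsi (q : nat) (s x t : R) : R :=
  - (Nconst q s * limn (series (fun n : nat =>
    coef q s n * sin (q%:R ^+ n * x) * sin (q%:R ^+ (2 * n) * t)))).

Definition Pdens (q : nat) (s x t : R) : R := RePsi q s x t ^+ 2 + ImPsi q s x t ^+ 2.

Definition box_count (A : set (R * R)) (d : R) : nat :=
  (#|` fset_set [set m : int * int | exists p, A p /\
      (m.1%:~R * d <= p.1 <= (m.1 + 1)%:~R * d) /\
      (m.2%:~R * d <= p.2 <= (m.2 + 1)%:~R * d)] |)%fset.

Definition box_ratio (A : set (R * R)) (d : R) : \bar R :=
  (ln ((box_count A d)%:R) / ln (1 / d))%:E.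

Definition upper_box_dim (A : set (R * R)) : \bar R :=
  limf_esup (box_ratio A) (0 : R)^'+.
Definition lower_box_dim (A : set (R * R)) : \bar R :=
  limf_einf (box_ratio A) (0 : R)^'+.

Definition has_box_dim (A : set (R * R)) (D : R) : Prop :=
  upper_box_dim A = lower_box_dim A /\ upper_box_dim A = D%:E.

Definition graph_on (f : R -> R) (a b : R) : set (R * R) :=
  [set p | a <= p.1 <= b /\ p.2 = f p.1].

End Defs.

(* Main.v *)
Require Import Defs.
From HB Require Import structures.
From mathcomp Require Import all_boot all_order all_algebra.
From mathcomp Require Import finmap.
From mathcomp Require Import all_classical all_reals all_analysis.
From mathcomp Require Import measurable_realfun ring lra.
Set Implicit Arguments. Unset Strict Implicit. Unset Printing Implicit Defensive.
Import Order.TTheory GRing.Theory Num.Theory.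
Import numFieldNormedType.Exports.
Local Open Scope classical_set_scope.
Local Open Scope ring_scope.

(* Put l = q^2, be = q^(s-2) and a_k = be^k sin (q^k x), so that Psi = N sum_k a_k e^(-i l^k t).
   Splitting the series at k = n gives |Psi(t) - Psi(t')| = O(be^n) when |t - t'| <= 2 l^-n, hence
   the upper bound O((l^2 be)^n) for the number of boxes of side about l^-n.
   For the lower bound, Borel-Cantelli gives |sin (q^n x)| >= c / (n+1)^2 eventually, for almost
   every x. The shift h = 2 pi / l^(n+1) is a period of all terms of index > n, so the increments of
   Psi along t0 + j h are trigonometric polynomials of degree l^n. Correlating u Re + v Im of them
   with the wave of frequency l^n over (n+1)^3 steps isolates a_n: one of the increments is at least
   c (|u| + |v|) be^n / (n+1)^2. With (u, v) = (1, 0) this shows that Psi does not vanish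
   identically on an interval; with (u, v) = Psi(t0) <> 0 it shows that |Psi|^2 oscillates by at least
   c be^n / (n+1)^2 on every window of length 2 (n+1)^3 l^-n, since |Psi|^2 is linearised at t0 up to
   O((n+1)^3 be^(2n)). The intermediate value theorem then yields at least
   c (l^2 be)^n / (n+1)^5 boxes, and ln (l^2 be) / ln l = 1 + s/2. *)

(** * Trigonometric sums along arithmetic progressions *)

Section TrigonometricSums.
Variable R : realType.
Implicit Types (x y theta beta kappa u v : R) (J : nat).

Lemma bounded_derivative_lipschitz (f df : R -> R) (K : R) :
  (forall x : R, is_derive x 1 f (df x)) -> (forall x, `|df x| <= K) ->
  forall x y : R, `|f x - f y| <= K * `|x - y|.
Proof.
move=> fdf dfK x y; wlog le_yx : x y / y <= x.
  move=> H; have [/H//|/ltW/H] := leP y x.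
  by rewrite distrC (distrC x).
have [|c _ ->] := @MVT_segment R f df y x le_yx.
  by apply: derivable_within_continuous => z _; exact: ex_derive.
by rewrite normrM ler_wpM2r.
Qed.

Lemma sin_lipschitz x y : `|sin x - sin y| <= `|x - y|.
Proof.
rewrite -[leRHS]mul1r; apply: (@bounded_derivative_lipschitz _ cos) => z; exact: cos_max.
Qed.

Lemma cos_lipschitz x y : `|cos x - cos y| <= `|x - y|.
Proof.
rewrite -[leRHS]mul1r; apply: (@bounded_derivative_lipschitz _ (fun z => - sin z)) => z.
by rewrite normrN sin_max.
Qed.

Lemma sum_cos_arith beta theta J :
  2 * sin (theta / 2) * \sum_(j < J) cos (beta + j%:R * theta) =
  sin (beta + J%:R * theta - theta / 2) - sin (beta - theta / 2).
Proof.
elim: J => [|J IH]; first by rewrite big_ord0 mul0r addr0 mulr0 subrr.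
rewrite big_ord_recr /= mulrDr IH.
have -> : beta + J.+1%:R * theta - theta / 2 = beta + J%:R * theta + theta / 2.
  by rewrite -natr1; field.
set x := beta + J%:R * theta; rewrite (sinD x (theta / 2)) (sinB x); ring.
Qed.

Lemma norm_sum_cos_arith beta theta kappa J :
  0 < kappa -> kappa <= sin (theta / 2) ->
  `|\sum_(j < J) cos (beta + j%:R * theta)| <= kappa^-1.
Proof.
move=> kappa0 hk; rewrite -(ler_pM2l (ltr0Sn _ 1)).
have s0 : 0 < sin (theta / 2) := lt_le_trans kappa0 hk.
have -> : 2%:R * `|\sum_(j < J) cos (beta + j%:R * theta)| =
  `|sin (beta + J%:R * theta - theta / 2) - sin (beta - theta / 2)| / sin (theta / 2).
  rewrite -sum_cos_arith !normrM (gtr0_norm s0) (gtr0_norm (ltr0Sn _ 1)).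
  by field; rewrite gt_eqF.
apply: ler_pM => //; first by rewrite invr_ge0 ltW.
  apply: (le_trans (ler_normB _ _)); rewrite -[2%:R]/(1 + 1 : R).
  by apply: lerD; exact: sin_max.
by rewrite lef_pV2 ?posrE.
Qed.

Lemma norm_sum_sin_arith beta theta kappa J :
  0 < kappa -> kappa <= sin (theta / 2) ->
  `|\sum_(j < J) sin (beta + j%:R * theta)| <= kappa^-1.
Proof.
move=> k0 hk; rewrite (eq_bigr (fun j : 'I_J => cos (beta - pi / 2 + j%:R * theta))).
  exact: norm_sum_cos_arith.
by move=> j _; rewrite -cosBpihalf; congr cos; ring.
Qed.

(* u (cos (x + e) - cos (x - e)) + v (sin (x + e) - sin (x - e)) = - 2 sin e * wave u v x. *)
Definition wave u v x : R := u * sin x - v * cos x.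

Lemma norm_wave u v x : `|wave u v x| <= `|u| + `|v|.
Proof.
apply: (le_trans (ler_normB _ _)); rewrite !normrM.
by apply: lerD; rewrite ler_piMr ?sin_max ?cos_max.
Qed.

Lemma waveM u v x y : wave u v x * wave u v y =
  (u ^+ 2 + v ^+ 2) / 2 * cos (y - x) + (v ^+ 2 - u ^+ 2) / 2 * cos (x + y)
  - u * v * sin (x + y).
Proof. by rewrite /wave cosB cosD sinD; field. Qed.

Section WaveCorrelation.
Variables (u v x0 y0 dx dy kappa : R) (J : nat).
Hypothesis kappa0 : 0 < kappa.
Hypothesis hD : kappa <= sin ((dx + dy) / 2).

Let r2 := u ^+ 2 + v ^+ 2.
Let x (j : nat) := x0 + j%:R * dx.
Let y (j : nat) := y0 + j%:R * dy.

Let cross : `|\sum_(j < J) ((v ^+ 2 - u ^+ 2) / 2 * cos (x j + y j)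
  - u * v * sin (x j + y j))| <= r2 * kappa^-1.
Proof.
have E j : x j + y j = x0 + y0 + j%:R * (dx + dy) by rewrite /x /y; ring.
under eq_bigr do rewrite E.
rewrite sumrB -!mulr_sumr; apply: (le_trans (ler_normB _ _)); rewrite !(normrM (_ / _)) (normrM (_ * _)).
have H1 := norm_sum_cos_arith (x0 + y0) J kappa0 hD.
have H2 := norm_sum_sin_arith (x0 + y0) J kappa0 hD.
have a1 : `|(v ^+ 2 - u ^+ 2) / 2| <= r2 / 2.
  have := sqr_ge0 u; have := sqr_ge0 v.
  by rewrite /r2 ler_norml => ? ?; apply/andP; split; lra.
have a2 : `|u * v| <= r2 / 2.
  have := sqr_ge0 (u - v); have := sqr_ge0 (u + v); rewrite sqrrD sqrrB.
  by rewrite /r2 ler_norml => ? ?; apply/andP; split; lra.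
apply: (le_trans (lerD (ler_pM _ _ a1 H1) (ler_pM _ _ a2 H2))) => //.
by rewrite -mulrDl -splitr.
Qed.

Lemma norm_sum_waveM : kappa <= sin ((dy - dx) / 2) ->
  `|\sum_(j < J) wave u v (x j) * wave u v (y j)| <= 2 * r2 * kappa^-1.
Proof.
move=> hB; under eq_bigr do rewrite waveM -addrA.
rewrite big_split /= -/r2.
apply: (le_trans (ler_normD _ _)).
have -> : 2 * r2 * kappa^-1 = r2 * kappa^-1 + r2 * kappa^-1 by ring.
apply: lerD cross.
have E j : y j - x j = y0 - x0 + j%:R * (dy - dx) by rewrite /x /y; ring.
under eq_bigr do rewrite E.
rewrite -mulr_sumr normrM; apply: ler_pM => //; last exact: norm_sum_cos_arith.
have : 0 <= r2 by rewrite /r2 addr_ge0 ?sqr_ge0.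
by move=> ?; rewrite ger0_norm ?ler_pdivrMr//; [rewrite ler_peMr// ler1n|rewrite divr_ge0].
Qed.

Lemma sum_wave_sqr_ge : x =1 y ->
  r2 * (J%:R / 2 - kappa^-1) <= \sum_(j < J) wave u v (x j) ^+ 2.
Proof.
move=> exy; have -> : \sum_(j < J) wave u v (x j) ^+ 2 =
   r2 * (J%:R / 2) + \sum_(j < J) ((v ^+ 2 - u ^+ 2) / 2 * cos (x j + y j)
  - u * v * sin (x j + y j)).
  have -> : r2 * (J%:R / 2) = \sum_(j < J) (r2 / 2).
    by rewrite sumr_const card_ord -[RHS]mulr_natr mulrA mulrAC.
  rewrite -big_split /=; apply: eq_bigr => j _.
  by rewrite expr2 -(exy j) waveM subrr cos0 mulr1 [RHS]addrA.
rewrite mulrBr; apply: lerD => //.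
by have := cross; rewrite ler_norml => /andP[].
Qed.

End WaveCorrelation.
End TrigonometricSums.

Section GeometricSums.
Variable R : realType.
Implicit Types z : R.

Lemma sum_geometric_lt1 z n : 0 <= z < 1 -> \sum_(k < n) z ^+ k <= (1 - z)^-1.
Proof.
move=> /andP[z0 z1]; have d0 : 0 < 1 - z by rewrite subr_gt0.
rewrite -[leRHS]mul1r ler_pdivlMr// mulrC.
have := subrX1 z n; rewrite -opprB -(opprB 1) mulNr => /oppr_inj <-.
by rewrite gerBl exprn_ge0.
Qed.

Lemma sum_geometric_gt1 z n : 1 < z -> \sum_(k < n) z ^+ k <= z ^+ n / (z - 1).
Proof.
move=> z1; have d0 : 0 < z - 1 by rewrite subr_gt0.
by rewrite ler_pdivlMr// mulrC -subrX1 gerBl.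
Qed.

Lemma poly_geometric_small z p (e : R) : 0 < z < 1 -> 0 < e ->
  exists n0, forall n, (n0 <= n)%N -> n.+1%:R ^+ p * z ^+ n <= e.
Proof.
move=> /andP[z0 z1] e0; pose L := - ln z.
have L0 : 0 < L by rewrite oppr_gt0 ln_lt0// z0.
pose K := p.+1`!%:R / (L ^+ p.+1 * z).
have K0 : 0 < K by rewrite divr_gt0 ?ltr0n ?fact_gt0// mulr_gt0// exprn_gt0.
exists (Num.truncn (K / e)) => n nK; set M : R := n.+1%:R.
have M0 : 0 < M by rewrite ltr0n.
have KM : K / M <= e.
  rewrite ler_pdivrMr// mulrC -ler_pdivrMr//.
  have /andP[_ /ltW/le_trans] := truncn_itv (ltW (divr_gt0 K0 e0)); apply.
  by rewrite ler_nat ltnS.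
apply: le_trans KM; rewrite ler_pdivlMr//.
have -> : M ^+ p * z ^+ n * M = M ^+ p.+1 * z ^+ n by rewrite exprS; ring.
have ML0 : 0 <= M * L by rewrite mulr_ge0 ?ltW.
have := expR_ge1Dxn p ML0.
have -> : expR (M * L) = (z ^+ n.+1)^-1.
  by rewrite /L mulrN expRN mulr_natl -lnXn// lnK// posrE exprn_gt0.
have f0 : 0 < p.+1`!%:R :> R by rewrite ltr0n fact_gt0.
have zn : 0 < z ^+ n.+1 by rewrite exprn_gt0.
move=> /(le_trans _) -/(_ ((M * L) ^+ p.+1 / p.+1`!%:R)).
rewrite lerDr ler01 => /(_ isT); rewrite ler_pdivrMr// ler_pdivlMl// exprMn.
rewrite /K ler_pdivlMr ?mulr_gt0 ?exprn_gt0// => H.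
apply: le_trans H; rewrite (exprS z n) le_eqVlt; apply/orP; left; apply/eqP.
by move: (M ^+ _) (L ^+ _) (z ^+ _) => X Y Z; ring.
Qed.

End GeometricSums.

(** * Lacunary series in time *)

Section LacunarySeries.
Variables (R : realType) (m : nat) (be : R) (a : nat -> R).
Let l : R := m%:R.
Hypothesis m4 : (4 <= m)%N.
Hypothesis be01 : 0 < be < 1.
Hypothesis lbe : 1 < l * be.
Hypothesis a_le : forall k, `|a k| <= be ^+ k.
Implicit Types (t u v : R) (phi : R -> R).

Definition lacunary phi t : R := limn (series (fun k => a k * phi (l ^+ k * t))).

Let be0 : 0 < be. Proof. by case/andP: be01. Qed.
Let be1 : be < 1. Proof. by case/andP: be01. Qed.
Let l4 : 4 <= l. Proof. by rewrite ler_nat. Qed.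
Let l0 : 0 < l. Proof. by apply: lt_le_trans l4. Qed.
Let lX n : 0 < l ^+ n. Proof. exact: exprn_gt0. Qed.
Let beX n : 0 < be ^+ n. Proof. exact: exprn_gt0. Qed.

Lemma cvg_lacunary phi t : (forall x, `|phi x| <= 1) ->
  cvgn (series (fun k => a k * phi (l ^+ k * t))).
Proof.
move=> phi1; apply: normed_cvg.
apply: (@series_le_cvg _ _ (geometric 1 be)) => [n|n|n|].
- exact: normr_ge0.
- by rewrite /= mul1r ltW.
- by rewrite /= mul1r normrM -[leRHS]mulr1 ler_pM.
- by apply: is_cvg_geometric_series; rewrite gtr0_norm.
Qed.

Definition holder_const : R := 2 / (l * be - 1) + 2 / (1 - be).

Lemma holder_const_gt0 : 0 < holder_const.
Proof. by rewrite addr_gt0// divr_gt0// subr_gt0. Qed.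

Section Phase.
Variable phi : R -> R.
Hypothesis phi1 : forall x, `|phi x| <= 1.
Hypothesis phi_lip : forall x y, `|phi x - phi y| <= `|x - y|.

Lemma lacunary_holder n t t' : `|t - t'| <= 2 / l ^+ n ->
  `|lacunary phi t - lacunary phi t'| <= holder_const * be ^+ n.
Proof.
move=> tt'; rewrite /lacunary -lim_seriesB; [|exact: cvg_lacunary..].
set d := (X in series X).
have cd : cvgn (series d) by apply: is_cvg_seriesB; exact: cvg_lacunary.
have dE k : `|d k| = `|a k| * `|phi (l ^+ k * t) - phi (l ^+ k * t')|.
  by rewrite -normrM; congr `|_|; rewrite /d [LHS]/(_ - _) mulrBr.
have d2 k : `|d k| <= 2 * be ^+ k.
  rewrite dE mulrC; apply: ler_pM => //.
  by apply: (le_trans (ler_normB _ _)); rewrite -[2]/(1 + 1); apply: lerD.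
have dl k : `|d k| <= 2 / l ^+ n * (l * be) ^+ k.
  rewrite dE exprMn mulrA mulrC; apply: ler_pM => //.
  apply: (le_trans (phi_lip _ _)); rewrite -mulrBr normrM mulrC.
  by rewrite (gtr0_norm (lX k)) ler_pM2r.
rewrite -lim_norm//; apply: limr_le; first exact: is_cvg_norm.
apply: nearW => N; rewrite seriesEord /=.
apply: (le_trans (ler_norm_sum _ _ _)).
apply: (@le_trans _ _ (\sum_(k < n + N) `|d k|)).
  rewrite addnC big_split_ord /= lerDl; exact: sumr_ge0.
rewrite big_split_ord /= mulrDl; apply: lerD.
  apply: (@le_trans _ _ (\sum_(k < n) (2 / l ^+ n * (l * be) ^+ k))); first exact: ler_sum.
  rewrite -mulr_sumr.
  apply: (le_trans (ler_wpM2l _ (sum_geometric_gt1 _ lbe))); first by rewrite divr_ge0 ?ltW.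
  rewrite exprMn le_eqVlt; apply/orP; left; apply/eqP; field.
  by rewrite !gt_eqF// subr_gt0.
apply: (@le_trans _ _ (\sum_(k < N) (2 * be ^+ n * be ^+ k))).
  by apply: ler_sum => k _; apply: (le_trans (d2 _)); rewrite /= exprD mulrA.
rewrite -mulr_sumr.
apply: (le_trans (ler_wpM2l _ (sum_geometric_lt1 _ _))); first by rewrite mulr_ge0 ?ltW.
  by rewrite !ltW.
by rewrite mulrAC.
Qed.

Hypothesis phi_per : periodic phi (pi *+ 2).

(* The shift h is a period of every term of index larger than n. *)
Lemma lacunary_diff n t : let h := pi *+ 2 / l ^+ n.+1 in
  lacunary phi (t + h) - lacunary phi t =
  \sum_(k < n.+1) a k * (phi (l ^+ k * (t + h)) - phi (l ^+ k * t)).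
Proof.
move=> h; rewrite /lacunary -lim_seriesB; [|exact: cvg_lacunary..].
apply: cvg_lim => //; apply: cvg_near_cst.
exists n.+1 => // N /= nN; rewrite seriesEord /=.
rewrite -(subnKC nN) big_split_ord /= [X in _ + X]big1 ?addr0.
  by apply: eq_bigr => k _; rewrite mulrBr.
move=> k _; set i := (n.+1 + k)%N.
transitivity (a i * (phi (l ^+ i * (t + h)) - phi (l ^+ i * t))).
  by rewrite mulrBr.
rewrite {}/i.
suff -> : l ^+ (n.+1 + k) * (t + h) = l ^+ (n.+1 + k) * t + pi *+ 2 *+ (m ^ k).
  by rewrite periodicn// subrr mulr0.
rewrite -[_ *+ (m ^ k)]mulr_natr natrX -/l exprD /h; field.
by rewrite gt_eqF.
Qed.

End Phase.

(* Bounds from below the sines of the half-steps (pi / l) (1 -+ l^(k-n)), k < n, and 2 pi / l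
   which occur in the correlation sums. *)
Definition sin_gap : R := sin (3 / 4 * (pi / l)).
Definition low_const : R := sin_gap^-1 * (2 + 4 / (l * be - 1)).

Let pil : pi / l <= 1.
Proof. by rewrite ler_pdivrMr// mul1r; apply: le_trans l4; have := @pihalf_lt2 R; lra. Qed.
Let pil0 : 0 < pi / l. Proof. by rewrite divr_gt0// pi_gt0. Qed.
Let pilh : 2 * (pi / l) <= pi / 2.
Proof.
rewrite mulrA ler_pdivrMr// mulrAC -mulrA [2 * _]mulrC ler_pM2l ?pi_gt0//.
by rewrite ler_pdivlMr//; apply: le_trans l4; rewrite -natrM.
Qed.

Lemma sin_gap_le x : 3 / 4 * (pi / l) <= x <= 2 * (pi / l) -> sin_gap <= sin x.
Proof.
move=> /andP[x1 x2]; have := pil0; have := pilh => ? ?.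
case: (ltgtP (3 / 4 * (pi / l)) x) x1 => // [h _|<- _ //].
by apply: ltW; rewrite ltr_sin ?in_itv /=; lra.
Qed.

Lemma sin_gap_gt0 : 0 < sin_gap.
Proof. by apply: sin_gt0_pihalf; have := pil0; have := pilh; lra. Qed.

Section Correlation.
Variables (n J : nat) (t0 u v : R).
Let h : R := pi *+ 2 / l ^+ n.+1.
Let x k : R := l ^+ k * (t0 + h / 2).
Let d k : R := l ^+ k * h.
Let w k j : R := wave u v (x k + j%:R * d k).
Let t j : R := t0 + j%:R * h.

Let dE k : d k / 2 = pi / l * (l ^+ k / l ^+ n).
Proof. by rewrite /d /h exprS -mulr_natl; field; rewrite !gt_eqF. Qed.

Let incrementE (j : nat) :
  u * (lacunary cos (t j.+1) - lacunary cos (t j)) +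
  v * (lacunary sin (t j.+1) - lacunary sin (t j)) =
  \sum_(k < n.+1) - 2 * a k * sin (d k / 2) * w k j.
Proof.
have -> : t j.+1 = t j + h by rewrite /t -natr1; ring.
rewrite lacunary_diff; [|exact: cos_max|exact: cosD2pi].
rewrite lacunary_diff; [|exact: sin_max|exact: sinD2pi].
rewrite !mulr_sumr -big_split /=; apply: eq_bigr => k _.
have -> : l ^+ k * (t j + h) = x k + j%:R * d k + d k / 2.
  by rewrite /t /x /d; field.
have -> : l ^+ k * t j = x k + j%:R * d k - d k / 2.
  by rewrite /t /x /d; field.
rewrite /w /wave (cosD _ (d k / 2)) (cosB _ (d k / 2)) (sinD _ (d k / 2)) (sinB _ (d k / 2)).
ring.
Qed.

Let ratio k : (k < n)%N -> 0 < l ^+ k / l ^+ n <= 4^-1.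
Proof.
move=> kn; rewrite divr_gt0//= ler_pdivrMr// -(subnKC kn) addSn exprS exprD.
rewrite !mulrA -[leLHS]mulr1; apply: ler_pM => //; first by rewrite ltW.
  by rewrite ler_peMl ?(ltW (lX k))//; have := l4; lra.
by rewrite exprn_ege1//; apply: le_trans l4; rewrite ler1n.
Qed.

(* Correlate the increments with the wave of frequency l^n: its own contribution grows linearly
   in J, those of the lower frequencies stay bounded. *)
Lemma increments_correlation (eta : R) :
  (forall j, (j < J)%N ->
    `|u * (lacunary cos (t j.+1) - lacunary cos (t j)) +
      v * (lacunary sin (t j.+1) - lacunary sin (t j))| <= eta) ->
  (u ^+ 2 + v ^+ 2) * (sin (pi / l) * `|a n| * J%:R - low_const * be ^+ n) <=
  J%:R * ((`|u| + `|v|) * eta).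
Proof.
move=> D_le; set r2 := u ^+ 2 + v ^+ 2.
have r20 : 0 <= r2 by rewrite addr_ge0 ?sqr_ge0.
have sin_gap0 := sin_gap_gt0; have pl0 := pil0.
have K0 : 0 < sin_gap^-1 by rewrite invr_gt0.
pose T := \sum_(j < J) w n j * \sum_(k < n.+1) - 2 * a k * sin (d k / 2) * w k j.
have T_le : `|T| <= J%:R * ((`|u| + `|v|) * eta).
  have -> : J%:R * ((`|u| + `|v|) * eta) = \sum_(j < J) (`|u| + `|v|) * eta.
    by rewrite sumr_const card_ord mulr_natl.
  apply: (le_trans (ler_norm_sum _ _ _)); apply: ler_sum => j _.
  by rewrite normrM -incrementE; apply: ler_pM => //; [exact: norm_wave|exact: D_le].
apply: le_trans T_le.
have -> : T = \sum_(k < n) - 2 * a k * sin (d k / 2) * (\sum_(j < J) w k j * w n j) +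
    - 2 * a n * sin (pi / l) * \sum_(j < J) w n j ^+ 2.
  have -> : T = \sum_(k < n.+1) - 2 * a k * sin (d k / 2) * (\sum_(j < J) w k j * w n j).
    rewrite /T; under eq_bigr do rewrite mulr_sumr.
    rewrite exchange_big /=; apply: eq_bigr => k _; rewrite mulr_sumr.
    by apply: eq_bigr => j _; ring.
  by rewrite big_ord_recr /= dE divff ?gt_eqF// mulr1; congr (_ + _ * _).
have low : `|\sum_(k < n) - 2 * a k * sin (d k / 2) * (\sum_(j < J) w k j * w n j)| <=
    r2 * sin_gap^-1 * (4 / (l * be - 1)) * be ^+ n.
  apply: (le_trans (ler_norm_sum _ _ _)).
  apply: (@le_trans _ _ (\sum_(k < n) (4 * r2 * sin_gap^-1 / l ^+ n) * (l * be) ^+ k)).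
    apply: ler_sum => k _; have /andP[q0 q1] := ratio (ltn_ord k).
    have -> : 4 * r2 * sin_gap^-1 / l ^+ n * (l * be) ^+ k =
      (2 * be ^+ k) * (l ^+ k / l ^+ n) * (2 * r2 * sin_gap^-1).
      by rewrite exprMn; field; rewrite !gt_eqF.
    rewrite !(normrM _ (\sum_(_ < _) _)) !(normrM _ (sin _)).
    have Ha : `|- 2 * a k| <= 2 * be ^+ k.
      by rewrite normrM normrN (gtr0_norm (ltr0Sn _ 1)) ler_pM2l.
    have Hs : `|sin (d k / 2)| <= l ^+ k / l ^+ n.
      rewrite dE; have := sin_lipschitz (pi / l * (l ^+ k / l ^+ n)) 0.
      rewrite sin0 !subr0 => /le_trans; apply.
      have H : 0 < pi / l * (l ^+ k / l ^+ n) by exact: mulr_gt0.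
      by rewrite (gtr0_norm H) ler_piMl// ltW.
    apply: ler_pM => //; first exact: ler_pM.
    apply: norm_sum_waveM => //; apply: sin_gap_le.
      rewrite (mulrDl (d k)) !dE divff ?gt_eqF// -mulrDr; apply/andP; split; nra.
    rewrite (mulrBl _ (d n)) !dE divff ?gt_eqF// -mulrBr; apply/andP; split; nra.
  rewrite -mulr_sumr.
  apply: (le_trans (ler_wpM2l _ (sum_geometric_gt1 _ lbe))).
    by apply: divr_ge0; [apply: mulr_ge0; [apply: mulr_ge0|exact: ltW]|exact: ltW].
  rewrite exprMn le_eqVlt; apply/orP; left; apply/eqP; field.
  by rewrite !gt_eqF// subr_gt0.
have main : r2 * (J%:R / 2 - sin_gap^-1) <= \sum_(j < J) w n j ^+ 2.
  apply: (@sum_wave_sqr_ge _ u v (x n) (x n) (d n) (d n)) => //.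
  by apply: sin_gap_le; rewrite (mulrDl (d n)) !dE divff ?gt_eqF//; apply/andP; split; lra.
set A := \sum_(k < n) _ in low *; set B := \sum_(j < J) _ in main *.
have S0 : 0 < sin (pi / l).
  by apply: sin_gt0_pihalf; rewrite pl0/=; have := pilh; lra.
have S1 := sin_le1 (pi / l).
have tri : 2 * `|a n| * sin (pi / l) * B - `|A| <= `|A + - 2 * a n * sin (pi / l) * B|.
  have B0 : 0 <= B by apply: sumr_ge0 => j _; exact: sqr_ge0.
  have <- : `|- 2 * a n * sin (pi / l) * B| = 2 * `|a n| * sin (pi / l) * B.
    by rewrite !normrM normrN (gtr0_norm S0) (ger0_norm B0) (gtr0_norm (ltr0Sn _ 1)).
  by rewrite [A + _]addrC; exact: lerB_normD.
apply: le_trans tri; apply: le_trans (lerB _ low); last first.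
  by apply: ler_wpM2l main; rewrite !mulr_ge0// ltW.
rewrite /low_const.
have : sin (pi / l) * `|a n| * (r2 * sin_gap^-1) <= be ^+ n * (r2 * sin_gap^-1).
  apply: ler_wpM2r; first by rewrite mulr_ge0// ltW.
  by rewrite -[leRHS]mul1r; apply: ler_pM => //; rewrite ltW.
move=> aux; rewrite -subr_ge0.
rewrite [X in 0 <= X](_ : _ =
  2 * (be ^+ n * (r2 * sin_gap^-1) - sin (pi / l) * `|a n| * (r2 * sin_gap^-1))).
  by rewrite mulr_ge0// subr_ge0.
by field; rewrite !gt_eqF// subr_gt0.
Qed.
End Correlation.

Lemma norm_lacunary phi t : (forall x, `|phi x| <= 1) ->
  `|lacunary phi t| <= (1 - be)^-1.
Proof.
move=> phi1; have cd := @cvg_lacunary phi t phi1.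
rewrite -lim_norm//; apply: limr_le; first exact: is_cvg_norm.
apply: nearW => N; rewrite seriesEord /=.
apply: (le_trans (ler_norm_sum _ _ _)).
apply: (@le_trans _ _ (\sum_(k < N) be ^+ k)); last by apply: sum_geometric_lt1; rewrite !ltW.
by apply: ler_sum => k _; rewrite normrM -[leRHS]mulr1; apply: ler_pM.
Qed.

Definition intensity t : R := lacunary cos t ^+ 2 + lacunary sin t ^+ 2.

Lemma intensity_holder n t t' : `|t - t'| <= 2 / l ^+ n ->
  `|intensity t - intensity t'| <= 4 / (1 - be) * holder_const * be ^+ n.
Proof.
move=> tt'; rewrite /intensity.
have sq phi : (forall x, `|phi x| <= 1) -> (forall x y, `|phi x - phi y| <= `|x - y|) ->
    `|lacunary phi t ^+ 2 - lacunary phi t' ^+ 2| <= 2 / (1 - be) * (holder_const * be ^+ n).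
  move=> phi1 philip; rewrite subr_sqr normrM mulrC; apply: ler_pM => //.
    apply: (le_trans (ler_normD _ _)); rewrite mulr_natl mulr2n.
    by apply: lerD; exact: norm_lacunary.
  exact: lacunary_holder.
have Hc := sq cos (@cos_max R) (@cos_lipschitz R).
have Hs := sq sin (@sin_max R) (@sin_lipschitz R).
have -> : forall c s c' s' : R, c + s - (c' + s') = (c - c') + (s - s') by move=> *; ring.
apply: (le_trans (ler_normD _ _)); apply: (le_trans (lerD Hc Hs)).
by rewrite le_eqVlt; apply/orP; left; apply/eqP; field; rewrite gt_eqF// subr_gt0.
Qed.

Section LargeCoefficients.
Variables (kappa : R) (n0 : nat).
Hypothesis kappa0 : 0 < kappa.
Hypothesis a_ge : forall n, (n0 <= n)%N -> kappa * be ^+ n <= `|a n| * n.+1%:R ^+ 2.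

Let node n t0 (j : nat) : R := t0 + j%:R * (pi *+ 2 / l ^+ n.+1).

Let sin_pil : 0 < sin (pi / l).
Proof. by apply: sin_gt0_pihalf; rewrite pil0/=; have := pilh; have := pil0; lra. Qed.

Let incr_const : R := sin (pi / l) * kappa / 4.
Let incr_const_gt0 : 0 < incr_const.
Proof. by rewrite /incr_const divr_gt0// mulr_gt0. Qed.

Lemma increments_large : exists n1, forall n, (n1 <= n)%N -> forall t0 u v (eta : R),
  (forall j, (j < n.+1 ^ 3)%N ->
    `|u * (lacunary cos (node n t0 j.+1) - lacunary cos (node n t0 j)) +
      v * (lacunary sin (node n t0 j.+1) - lacunary sin (node n t0 j))| <= eta) ->
  incr_const * (`|u| + `|v|) * be ^+ n <= eta * n.+1%:R ^+ 2.
Proof.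
have sk : 0 < sin (pi / l) * kappa by rewrite mulr_gt0.
exists (maxn n0 (Num.truncn (2 * low_const / (sin (pi / l) * kappa)))) => n.
rewrite geq_max => /andP[n0n n1n] t0 u v eta D_le.
have := increments_correlation D_le; set M : R := n.+1%:R.
set p := `|u| + `|v| => corr.
have M0 : 0 < M by rewrite ltr0n.
have : 2 * low_const / (sin (pi / l) * kappa) <= M.
  have [x0|x0] := leP 0 (2 * low_const / (sin (pi / l) * kappa)); last first.
    by apply: le_trans (ltW M0); exact: ltW.
  have /andP[_ /ltW/le_trans] := truncn_itv x0; apply.
  by rewrite ler_nat ltnS.
rewrite ler_pdivrMr// => MC'.
have MC : low_const <= sin (pi / l) * kappa * M / 2 by lra.
have eta0 : 0 <= eta by apply: le_trans (D_le 0%N _); rewrite ?expn_gt0.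
have p0 : 0 <= p by rewrite addr_ge0.
have [pz|pnz] := eqVneq p 0.
  by rewrite pz mulr0 mul0r mulr_ge0// exprn_ge0// ltW.
have pp : 0 < p by rewrite lt_neqAle eq_sym pnz.
have pr : p ^+ 2 / 2 <= u ^+ 2 + v ^+ 2.
  rewrite /p sqrrD !real_normK ?num_real//.
  have := sqr_ge0 (`|u| - `|v|); rewrite sqrrB !real_normK ?num_real//.
  by lra.
move: corr; rewrite natrX -/M => corr.
have low : sin (pi / l) * kappa * M / 2 * be ^+ n <=
    sin (pi / l) * `|a n| * M ^+ 3 - low_const * be ^+ n.
  have : low_const * be ^+ n <= sin (pi / l) * kappa * M / 2 * be ^+ n by rewrite ler_pM2r.
  have : sin (pi / l) * M * (kappa * be ^+ n) <= sin (pi / l) * M * (`|a n| * M ^+ 2).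
    by rewrite ler_pM2l ?mulr_gt0//; exact: a_ge.
  by rewrite (exprS M 2); lra.
have : p ^+ 2 / 2 * (sin (pi / l) * kappa * M / 2 * be ^+ n) <= M ^+ 3 * (p * eta).
  apply: le_trans corr; apply: ler_pM => //.
    by rewrite divr_ge0// sqr_ge0.
  by rewrite !mulr_ge0 ?ltW.
have -> : p ^+ 2 / 2 * (sin (pi / l) * kappa * M / 2 * be ^+ n) =
   (M * p) * (incr_const * p * be ^+ n) by rewrite /incr_const; field.
have -> : M ^+ 3 * (p * eta) = (M * p) * (eta * M ^+ 2) by ring.
by rewrite ler_pM2l// mulr_gt0.
Qed.

Let step_le n t0 j : `|node n t0 j.+1 - node n t0 j| <= 2 / l ^+ n.
Proof.
rewrite /node -natr1 -[pi *+ 2]mulr_natl exprS.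
have -> : t0 + (j%:R + 1) * (2 * pi / (l * l ^+ n)) - (t0 + j%:R * (2 * pi / (l * l ^+ n)))
  = pi / l * (2 / l ^+ n) by field; rewrite !gt_eqF.
have p0 : 0 < 2 / l ^+ n by rewrite divr_gt0.
have H : 0 < pi / l * (2 / l ^+ n) by rewrite mulr_gt0.
by rewrite (gtr0_norm H) ler_piMl ?pil// ltW.
Qed.

Let node_itv n t0 j J : (j <= J)%N ->
  t0 <= node n t0 j <= t0 + J%:R * (2 / l ^+ n).
Proof.
move=> jJ; have p0 : 0 < 2 / l ^+ n by rewrite divr_gt0.
have E : pi *+ 2 / l ^+ n.+1 = pi / l * (2 / l ^+ n).
  by rewrite -[pi *+ 2]mulr_natl exprS; field; rewrite !gt_eqF.
have H : 0 <= pi / l * (2 / l ^+ n) by rewrite ltW// mulr_gt0.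
rewrite /node E lerDl lerD2l mulr_ge0//=.
by apply: ler_pM => //; [rewrite ler_nat|rewrite ler_piMl// ltW].
Qed.

Let lV01 : 0 < l^-1 < 1.
Proof. by rewrite invr_gt0 l0 invf_lt1//; apply: lt_le_trans l4; rewrite ltr1n. Qed.

Lemma lacunary_cos_neq0 c d : c < d -> exists t, c < t < d /\ lacunary cos t != 0.
Proof.
move=> cd; have [n1 H] := increments_large.
have e0 : 0 < (d - c) / 8 by rewrite divr_gt0// subr_gt0.
have [n2 H2] := @poly_geometric_small R l^-1 3 _ lV01 e0.
pose n := maxn n1 n2; pose t0 := c + (d - c) / 4.
have win : (n.+1 ^ 3)%:R * (2 / l ^+ n) <= (d - c) / 4.
  have := H2 n (leq_maxr _ _); rewrite natrX exprVn => Hn.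
  rewrite mulrCA; lra.
have [//|nex] := pselect (exists t, c < t < d /\ lacunary cos t != 0).
have Z j : (j <= n.+1 ^ 3)%N -> lacunary cos (node n t0 j) = 0.
  move=> jJ; have /andP[n1' n2'] := node_itv n t0 jJ.
  apply/eqP/negP => /negP nz; apply: nex; exists (node n t0 j); split => //.
  by apply/andP; split; rewrite /t0 in n1' n2' *; lra.
have : incr_const * (`|1 : R| + `|0 : R|) * be ^+ n <= 0 * n.+1%:R ^+ 2.
  apply: (H n (leq_maxl _ _) t0 1 0 0) => j jJ.
  by rewrite !Z// ?(ltnW jJ)// subrr mulr0 mul0r addr0 normr0.
by rewrite normr1 normr0 addr0 mulr1 mul0r leNgt mulr_gt0.
Qed.

Lemma intensity_oscillation c d : c < d -> exists c' d' (e : R) (n1 : nat),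
  [/\ c <= c', c' < d', d' <= d, 0 < e & forall n, (n1 <= n)%N ->
    forall t0, c' <= t0 <= d' -> exists t t',
    [/\ t0 <= t <= t0 + n.+1%:R ^+ 3 * (2 / l ^+ n),
        t0 <= t' <= t0 + n.+1%:R ^+ 3 * (2 / l ^+ n) &
        e * be ^+ n <= `|intensity t - intensity t'| * n.+1%:R ^+ 2]].
Proof.
move=> cd; have [ts [/andP[cts tsd] nz]] := lacunary_cos_neq0 cd.
pose B := `|lacunary cos ts|; have B0 : 0 < B by rewrite normr_gt0.
have H0 := holder_const_gt0.
have e1 : 0 < B / 2 / holder_const by rewrite !divr_gt0.
have [k1 K1] := @poly_geometric_small R be 0 _ be01 e1.
have e2 : 0 < (d - ts) / 2 by rewrite divr_gt0// subr_gt0.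
have [k2 K2] := @poly_geometric_small R l^-1 0 ((d - ts) / 2) lV01 e2.
pose k := maxn k1 k2.
have He : 0 < incr_const * (B / 2) by rewrite mulr_gt0// divr_gt0.
have e3 : 0 < incr_const * (B / 2) / (8 * holder_const ^+ 2).
  by rewrite divr_gt0// mulr_gt0// exprn_gt0.
have [n1 N1] := @poly_geometric_small R be 5 _ be01 e3.
have [n2 N2] := increments_large.
exists ts, (ts + 2 / l ^+ k), (incr_const * (B / 2)), (maxn n1 n2); split => //.
- exact: ltW.
- by rewrite ltrDl divr_gt0.
- have := K2 k (leq_maxr _ _); rewrite expr0 mul1r exprVn; lra.
move=> n; rewrite geq_max => /andP[n1n n2n] t0 /andP[tst0 t0k].
have ct0 : B / 2 <= `|lacunary cos t0|.
  have close : `|ts - t0| <= 2 / l ^+ k.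
    by rewrite distrC ger0_norm ?subr_ge0// lerBlDl.
  have := lacunary_holder (@cos_max R) (@cos_lipschitz R) close.
  have := K1 k (leq_maxl _ _); rewrite expr0 mul1r ler_pdivlMr// mulrC => ? ?.
  by have := lerB_dist (lacunary cos ts) (lacunary cos t0); rewrite -/B; lra.
set M : R := n.+1%:R; have M0 : 0 < M by rewrite ltr0n.
have [//|nex] := pselect (exists t t',
    [/\ t0 <= t <= t0 + M ^+ 3 * (2 / l ^+ n), t0 <= t' <= t0 + M ^+ 3 * (2 / l ^+ n) &
        incr_const * (B / 2) * be ^+ n <= `|intensity t - intensity t'| * M ^+ 2]).
pose HB := holder_const * be ^+ n.
have HB0 : 0 < HB by rewrite mulr_gt0.
pose J := (n.+1 ^ 3)%N; have JM : J%:R = M ^+ 3 by rewrite natrX.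
pose u := lacunary cos t0; pose v := lacunary sin t0.
have drift phi j : (forall x, `|phi x| <= 1) ->
    (forall x y, `|phi x - phi y| <= `|x - y|) -> (j <= J)%N ->
    `|lacunary phi (node n t0 j) - lacunary phi t0| <= M ^+ 3 * HB.
  move=> phi1 philip jJ.
  apply: (@le_trans _ _ (j%:R * HB)); last by rewrite -JM ler_pM2r// ler_nat.
  elim: {jJ}j => [|j IH]; first by rewrite /node mul0r addr0 subrr normr0 mul0r.
  rewrite -natr1 mulrDl mul1r [leRHS]addrC.
  rewrite -(subrKA (lacunary phi (node n t0 j))).
  apply: (le_trans (ler_normD _ _)); apply: lerD => //.
  exact: lacunary_holder (step_le _ _ _).
have product phi j : (forall x, `|phi x| <= 1) ->
    (forall x y, `|phi x - phi y| <= `|x - y|) -> (j < J)%N ->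
    `|(lacunary phi (node n t0 j.+1) - lacunary phi (node n t0 j)) *
      (lacunary phi (node n t0 j.+1) + lacunary phi (node n t0 j) - 2 * lacunary phi t0)|
    <= HB * (2 * (M ^+ 3 * HB)).
  move=> phi1 philip jJ; rewrite normrM; apply: ler_pM => //.
    exact: lacunary_holder (step_le _ _ _).
  have -> : forall x y z : R, x + y - 2 * z = (x - z) + (y - z) by move=> *; ring.
  apply: (le_trans (ler_normD _ _)); rewrite mulr_natl mulr2n.
  by apply: lerD; apply: drift => //; exact: ltnW.
pose eta := incr_const * (B / 2) * be ^+ n / M ^+ 2 / 2 + 2 * M ^+ 3 * HB ^+ 2.
have : incr_const * (`|u| + `|v|) * be ^+ n <= eta * M ^+ 2.
  apply: (N2 n n2n t0 u v) => j jJ.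
  have PP : `|intensity (node n t0 j.+1) - intensity (node n t0 j)| <=
      incr_const * (B / 2) * be ^+ n / M ^+ 2.
    rewrite ler_pdivlMr ?exprn_gt0// leNgt; apply/negP => /ltW lt; apply: nex.
    exists (node n t0 j.+1), (node n t0 j).
    by rewrite -JM; split => //; apply: node_itv => //; exact: ltnW.
  have C := product cos j (@cos_max R) (@cos_lipschitz R) jJ.
  have S := product sin j (@sin_max R) (@sin_lipschitz R) jJ.
  move: PP C S; rewrite /intensity /eta -/u -/v !ler_norml.
  move: (incr_const * (B / 2) * be ^+ n / M ^+ 2) (M ^+ 3) (HB) (u) (v) => E Q Hb U V.
  move: (lacunary cos _) (lacunary cos _) (lacunary sin _) (lacunary sin _) => c1 c0 s1 s0.
  by move=> /andP[? ?] /andP[? ?] /andP[? ?]; apply/andP; split; lra.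
have : incr_const * (B / 2) * be ^+ n <= incr_const * (`|u| + `|v|) * be ^+ n.
  by rewrite ler_pM2r// ler_pM2l//; apply: (le_trans ct0); rewrite lerDl.
have := N1 n n1n; rewrite -/M ler_pdivlMr ?mulr_gt0 ?exprn_gt0// => small.
have : (M ^+ 5 * be ^+ n * (8 * holder_const ^+ 2)) * be ^+ n <= incr_const * (B / 2) * be ^+ n.
  by rewrite ler_pM2r.
have -> : eta * M ^+ 2 =
  incr_const * (B / 2) * be ^+ n / 2 + 2 * M ^+ 5 * holder_const ^+ 2 * be ^+ n * be ^+ n.
  by rewrite /eta /HB; field; rewrite gt_eqF.
have := mulr_gt0 He (beX n).
move: (incr_const * (B / 2) * be ^+ n) (incr_const * _ * _) => X Y ? ? ? ?; lra.
Qed.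

End LargeCoefficients.
End LacunarySeries.

(** * Box dimension of graphs *)

Section CardFsetSet.
Variables (T : choiceType) (I : finType) (g : I -> T) (S : set T).

Lemma finite_set_sub_range : S `<=` range g -> finite_set S.
Proof.
move=> Sg; apply: (sub_finite_set Sg); apply: finite_image.
exact: finite_finset.
Qed.

Lemma card_fset_set_le : S `<=` range g -> (#|` fset_set S| <= #|I|)%N.
Proof.
move=> Sg; have fS := finite_set_sub_range Sg.
apply: (@leq_trans #|` [fset g i | i in I]%fset|).
  apply: fsubset_leq_card; apply/fsubsetP => x.
  rewrite in_fset_set// inE => /Sg[i _ <-].
  by apply/imfsetP; exists i.
by apply: (leq_trans (leq_imfset_card _ _ _)); rewrite cardE.
Qed.

Lemma card_fset_set_ge : finite_set S -> injective g -> (forall i, S (g i)) ->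
  (#|I| <= #|` fset_set S|)%N.
Proof.
move=> fS ginj Sg.
have <- : #|` [fset g i | i in I]%fset| = #|I|.
  by rewrite card_imfset//= -cardE.
apply: fsubset_leq_card; apply/fsubsetP => x /imfsetP[i _ ->].
by rewrite in_fset_set// inE.
Qed.

End CardFsetSet.

Section LimitsOfFilters.
Variable R : realType.
Implicit Types (D e : R).

Lemma limf_esup_squeeze (F : set_system R) (f : R -> \bar R) D : ProperFilter F ->
  (forall e, 0 < e -> \forall x \near F, ((D - e)%:E <= f x <= (D + e)%:E)%E) ->
  limf_esup f F = D%:E.
Proof.
move=> PF near; rewrite limf_esupE; apply/eqP; rewrite eq_le; apply/andP; split.
  apply/lee_addgt0Pr => e e0; have Fe := near e e0.
  apply: (@le_trans _ _ (ereal_sup [set f x | x in [set x | ((D - e)%:E <= f x <= (D + e)%:E)%E]])).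
    by apply: ereal_inf_lbound; exists [set x | ((D - e)%:E <= f x <= (D + e)%:E)%E].
  by apply: ge_ereal_sup => _ [x /andP[_ ?] <-].
apply: le_ereal_inf_tmp => _ [V FV <-].
apply/lee_subgt0Pr => e e0; have Fe := near e e0.
have [x [Vx /andP[fx _]]] := @filter_ex _ F _ _ (filterI FV Fe).
by apply: (le_trans fx); apply: ereal_sup_ubound; exists x.
Qed.

Lemma limf_einf_squeeze (F : set_system R) (f : R -> \bar R) D : ProperFilter F ->
  (forall e, 0 < e -> \forall x \near F, ((D - e)%:E <= f x <= (D + e)%:E)%E) ->
  limf_einf f F = D%:E.
Proof.
move=> PF near; rewrite /limf_einf (@limf_esup_squeeze F _ (- D)) ?EFinN ?oppeK//.
move=> e e0; apply: filterS (near e e0) => x /andP[h1 h2].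
have -> : (- D - e)%:E = (- (D + e)%:E)%E :> \bar R by rewrite -EFinN opprD.
have -> : (- D + e)%:E = (- (D - e)%:E)%E :> \bar R by rewrite -EFinN opprB addrC.
by rewrite !leeN2 h1 h2.
Qed.

End LimitsOfFilters.

Lemma summands_le (R : realType) (u v w : R) : 0 <= u -> 0 <= v -> 0 <= w ->
  [/\ v <= u + v + w + 1, w <= u + v + w + 1, u <= u + v + w + 1 & 1 <= u + v + w + 1].
Proof. by move=> ? ? ?; split; lra. Qed.

Lemma log_count_squeeze (R : realType) (A B N M5 G n L D y eps : R) :
  N <= B + n * G -> A + n * G <= N + M5 -> M5 <= n * (eps * L / 2) ->
  `|B| <= y * eps -> 2 * (G + `|A|) <= y * eps ->
  n * G <= D * y -> D * y <= (n + 1) * G -> n * (eps * L / 2) <= eps * y / 2 ->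
  (D - eps) * y <= N <= (D + eps) * y.
Proof.
have := ler_norm B; have := ler_norm (- A); rewrite normrN => *.
by apply/andP; split; lra.
Qed.

Section BoxCounting.
Variables (R : realType) (m : nat) (be : R) (f : R -> R) (a b : R).
Let l : R := m%:R.
Hypothesis m4 : (4 <= m)%N.
Hypothesis be01 : 0 < be < 1.
Hypothesis lbe : 1 < l * be.
Hypothesis ab : a < b.

Let be0 : 0 < be. Proof. by case/andP: be01. Qed.
Let l4 : 4 <= l. Proof. by rewrite ler_nat. Qed.
Let l1 : 1 < l. Proof. by apply: lt_le_trans l4; rewrite ltr1n. Qed.
Let l0 : 0 < l. Proof. exact: lt_trans l1. Qed.
Let lX n : 0 < l ^+ n. Proof. exact: exprn_gt0. Qed.
Let beX n : 0 < be ^+ n. Proof. exact: exprn_gt0. Qed.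

Variable C : R.
Hypothesis C0 : 0 < C.
Hypothesis f_holder : forall n t t', `|t - t'| <= 2 / l ^+ n ->
  `|f t - f t'| <= C * be ^+ n.

Let boxes (d : R) : set (int * int) := [set k | exists p, graph_on f a b p /\
      (k.1%:~R * d <= p.1 <= (k.1 + 1)%:~R * d) /\
      (k.2%:~R * d <= p.2 <= (k.2 + 1)%:~R * d)].

Let int_between (x y : R) (k : int) : x - 1 <= k%:~R -> k%:~R <= y ->
  exists j : 'I_(Num.truncn (y - x)).+3, k = Num.floor x - 1 + j%:Z.
Proof.
move=> xk ky; have /andP[fx1 fx2] := floor_itv x.
have dif : 0 <= k - (Num.floor x - 1).
  by rewrite subr_ge0 -(ler_int R) rmorphB /=; lra.
have yx : 0 <= y - x + 1 by lra.
have lt_j : (absz (k - (Num.floor x - 1))%R < (Num.truncn (y - x)%R).+3)%N.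
  rewrite -(ltr_nat R) natr_absz ger0_norm// !rmorphB /=.
  have : y - x < (Num.truncn (y - x)).+1%:R.
    have [yx0|/lt_le_trans->//] := leP 0 (y - x).
    by have /andP[] := truncn_itv yx0.
  rewrite -!natr1; move: fx2; rewrite rmorphD /=; lra.
by exists (Ordinal lt_j); rewrite /= gez0_abs// addrC subrK.
Qed.

Section Scale.
Variables (n : nat) (d : R).
Hypothesis d0 : 0 < d.
Hypothesis d_le : d <= (l ^+ n)^-1.
Hypothesis d_gt : (l ^+ n.+1)^-1 < d.

Let dl : d <= 2 / l ^+ n.
Proof. by apply: (le_trans d_le); rewrite ler_peMl ?invr_ge0 ?ler1n// ltW. Qed.

Let K1 := (Num.truncn (b / d - a / d)).+3.
Let K2 := (Num.truncn (2 * (C * be ^+ n / d))).+3.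
Let box (ij : 'I_K1 * 'I_K2) : int * int :=
  let k1 := Num.floor (a / d) - 1 + (ij.1)%:Z in
  (k1, Num.floor ((f (k1%:~R * d) - C * be ^+ n) / d) - 1 + (ij.2)%:Z).

Let boxes_sub : boxes d `<=` range box.
Proof.
move=> [k1 k2] [[t y] /= [[/andP[at_ tb] /= ->] [/andP[k1t tk1] /andP[k2y yk2]]]].
rewrite /= !rmorphD /= in tk1 yk2.
have [||i Ei] := @int_between (a / d) (b / d) k1.
- by rewrite lerBlDr ler_pdivrMr// (le_trans at_).
- by rewrite ler_pdivlMr// (le_trans k1t).
have close : `|t - k1%:~R * d| <= 2 / l ^+ n.
  by apply: le_trans dl; rewrite ger0_norm ?subr_ge0//; lra.
have := f_holder close; rewrite ler_norml => /andP[lo hi].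
pose x := (f (k1%:~R * d) - C * be ^+ n) / d.
have [||j Ej] := @int_between x ((f (k1%:~R * d) + C * be ^+ n) / d) k2.
- rewrite lerBlDr ler_pdivrMr//; lra.
- rewrite ler_pdivlMr//; lra.
have EK : (Num.truncn ((f (k1%:~R * d) + C * be ^+ n) / d - x)).+3 = K2.
  by rewrite /K2 /x -mulrBl; congr (Num.truncn _).+3; ring.
exists (i, cast_ord EK j) => //; rewrite /box /=; congr pair => //.
by rewrite -Ei Ej.
Qed.

Lemma finite_boxes : finite_set (boxes d).
Proof. exact: finite_set_sub_range boxes_sub. Qed.

Lemma box_count_le :
  (box_count (graph_on f a b) d)%:R <=
  (b - a + 3) * l * (2 * C + 3) * l * (l ^+ 2 * be) ^+ n.
Proof.
have card := card_fset_set_le boxes_sub.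
rewrite card_prod !card_ord in card.
apply: (@le_trans _ _ (K1 * K2)%:R); first by rewrite ler_nat.
have trunc3 (x : R) : 0 <= x -> (Num.truncn x).+3%:R <= x + 3.
  by move=> x0; have /andP[+ _] := truncn_itv x0; rewrite -!natr1; lra.
have dV : d^-1 <= l * l ^+ n.
  by rewrite -exprS -[leRHS]invrK lef_pV2 ?posrE ?invr_gt0// ltW.
have ll : 1 <= l * l ^+ n by rewrite -exprS exprn_ege1// ltW.
have lbl : 1 <= (l * be) ^+ n by rewrite exprn_ege1// ltW.
have Kb1 : K1%:R <= (b - a + 3) * (l * l ^+ n).
  apply: (le_trans (trunc3 _ _)).
    by rewrite -mulrBl divr_ge0 ?subr_ge0// ltW.
  rewrite -mulrBl.
  have : (b - a) / d <= (b - a) * (l * l ^+ n) by rewrite ler_pM2l ?subr_gt0.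
  by lra.
have Kb2 : K2%:R <= (2 * C + 3) * (l * (l * be) ^+ n).
  apply: (le_trans (trunc3 _ _)).
    by rewrite mulr_ge0// divr_ge0 ?mulr_ge0 ?ltW.
  have : C * be ^+ n / d <= C * be ^+ n * (l * l ^+ n) by rewrite ler_pM2l ?mulr_gt0.
  have : 1 * 1 <= l * (l * be) ^+ n by apply: ler_pM => //; exact: ltW.
  by rewrite exprMn; lra.
rewrite natrM; apply: (le_trans (ler_pM _ _ Kb1 Kb2)) => //.
have -> : (l ^+ 2 * be) ^+ n = l ^+ n * (l * be) ^+ n by rewrite -exprMn mulrA -expr2.
by rewrite le_eqVlt; apply/orP; left; apply/eqP; ring.
Qed.

Section Lower.
Variables (c' d' e : R).
Let M : R := n.+1%:R.
Hypothesis ac' : a <= c'.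
Hypothesis d'b : d' <= b.
Hypothesis cd' : c' < d'.
Hypothesis e0 : 0 < e.
Hypothesis f_cont : continuous f.
Hypothesis osc : forall t0, c' <= t0 <= d' -> exists t t',
    [/\ t0 <= t <= t0 + M ^+ 3 * (2 / l ^+ n),
        t0 <= t' <= t0 + M ^+ 3 * (2 / l ^+ n) &
        e * be ^+ n <= `|f t - f t'| * M ^+ 2].

Let w : R := 4 * M ^+ 3 / l ^+ n.
Let Nw := Num.truncn ((d' - c') / w).
Let K := Num.truncn (e * be ^+ n / M ^+ 2 / d).
Let M0 : 0 < M. Proof. by rewrite ltr0n. Qed.
Let M1 : 1 <= M. Proof. by rewrite ler1n. Qed.
Let w0 : 0 < w. Proof. by rewrite divr_gt0// mulr_gt0// exprn_gt0. Qed.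
Let d_lt_w : d < w / 2.
Proof.
apply: (le_lt_trans d_le); rewrite /w -[ltLHS]mul1r mulrAC ltr_pM2r ?invr_gt0//.
have : 1 <= M ^+ 3 by rewrite exprn_ege1.
lra.
Qed.

(* The graph crosses K consecutive horizontal grid lines above the i-th window; distinct windows
   are more than d apart, so the boxes found above them are distinct. *)
Let window (i : 'I_Nw) : exists base : int, forall j : 'I_K, exists kt : int * R,
  [/\ c' + i%:R * w <= kt.2 <= c' + i%:R * w + w / 2,
      kt.1%:~R * d <= kt.2 <= (kt.1 + 1)%:~R * d &
      boxes d (kt.1, base + j%:Z)].
Proof.
have iw : c' + i%:R * w + w <= d'.
  have /andP[+ _] : Nw%:R <= (d' - c') / w < Nw.+1%:R.
    by apply: truncn_itv; rewrite divr_ge0 ?subr_ge0// ltW.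
  rewrite ler_pdivlMr//.
  have : i.+1%:R * w <= Nw%:R * w by rewrite ler_pM2r// ler_nat.
  by rewrite -natr1; lra.
have iw0 : 0 <= i%:R * w by rewrite mulr_ge0// ltW.
have E : M ^+ 3 * (2 / l ^+ n) = w / 2 by rewrite /w; field; rewrite gt_eqF.
have [|t [t' [tw tw' ht]]] := @osc (c' + i%:R * w).
  by apply/andP; split; have := w0; lra.
rewrite E in tw tw'.
wlog tt' : t t' tw tw' ht / t <= t'.
  move=> W; have [/W|/ltW/W] := leP t t'; first exact.
  by apply => //; rewrite distrC.
pose lo := Num.min (f t) (f t'); pose hi := Num.max (f t) (f t').
have hilo : hi - lo = `|f t - f t'|.
  rewrite /hi /lo; case: (leP (f t) (f t')) => [h|/ltW h].
    by rewrite distrC ger0_norm// subr_ge0.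
  by rewrite ger0_norm// subr_ge0.
exists (Num.floor (lo / d) + 1) => j.
have /andP[fl1 fl2] := floor_itv (lo / d).
pose k2 := Num.floor (lo / d) + 1 + j%:Z; pose y : R := k2%:~R * d.
have Kd : K%:R * d <= e * be ^+ n / M ^+ 2.
  rewrite -ler_pdivlMr//; have /andP[] : K%:R <= e * be ^+ n / M ^+ 2 / d < K.+1%:R.
    by apply: truncn_itv; rewrite !divr_ge0 ?mulr_ge0 ?exprn_ge0 ?ltW.
  by [].
have jd : j.+1%:R * d <= hi - lo.
  rewrite hilo; apply: (@le_trans _ _ (K%:R * d)); first by rewrite ler_pM2r// ler_nat.
  by apply: (le_trans Kd); rewrite ler_pdivrMr// exprn_gt0.
have yb : lo <= y <= hi.
  rewrite ler_pdivlMr// in fl1; rewrite ltr_pdivrMr// in fl2.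
  rewrite /y /k2 rmorphD /= -pmulrn; apply/andP; split.
    apply: (le_trans (ltW fl2)); rewrite ler_pM2r// lerDl//.
  move: jd; rewrite -natr1 rmorphD /=; lra.
have [||s s_in fs] := @IVT R f t t' y tt'; [|exact: yb|].
  by apply: continuous_subspaceT => z; exact: f_cont.
move: s_in; rewrite in_itv /= => /andP[ts st'].
move: tw tw' => /andP[tw1 tw2] /andP[tw1' tw2'].
have sw : c' + i%:R * w <= s <= c' + i%:R * w + w / 2 by apply/andP; split; lra.
have /andP[fs1 fs2] := floor_itv (s / d).
have sb : (Num.floor (s / d))%:~R * d <= s <= (Num.floor (s / d) + 1)%:~R * d.
  by rewrite -ler_pdivlMr// fs1/= -ler_pdivrMr// ltW.
exists (Num.floor (s / d), s); split => //=.
exists (s, y); split => /=; last split => //.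
- have /andP[sw1 sw2] := sw; have := w0; have := ac'; have := d'b => ? ? ?.
  by split => //=; apply/andP; split; lra.
- by rewrite /y lexx /= ler_pM2r// ler_int lerDl.
Qed.

Lemma box_count_ge : (Nw * K <= box_count (graph_on f a b) d)%N.
Proof.
have [base Hb] := choice window.
have [kt Hkt] := choice (fun ij : 'I_Nw * 'I_K => Hb ij.1 ij.2).
have <- : #|{: 'I_Nw * 'I_K}| = (Nw * K)%N by rewrite card_prod !card_ord.
apply: (@card_fset_set_ge _ _ (fun ij => ((kt ij).1, base ij.1 + (ij.2 : nat)%:Z))).
- exact: finite_boxes.
- move=> [i j] [i' j'] /= [k1 k2].
  have ii : i = i'.
    have [/andP[t1 t2] /andP[b1 b2] _] := Hkt (i, j).
    have [/andP[t1' t2'] /andP[b1' b2'] _] := Hkt (i', j').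
    move: b1 b2; rewrite k1 => b1 b2.
    have sep (p q : nat) (s s' : R) : (p < q)%N -> s <= c' + p%:R * w + w / 2 ->
        c' + q%:R * w <= s' -> d < s' - s.
      move=> pq hs hs'; have : p.+1%:R * w <= q%:R * w by rewrite ler_pM2r// ler_nat.
      by rewrite -natr1; have := d_lt_w; lra.
    apply/val_inj; case: (ltngtP (i : nat) i') => // lt_ii; exfalso.
      have := sep _ _ _ _ lt_ii t2 t1'.
      by move: b2' b1; rewrite intrD; lra.
    have := sep _ _ _ _ lt_ii t2' t1.
    by move: b2 b1'; rewrite intrD; lra.
  subst i'; congr pair; apply/val_inj.
  by move/addrI: k2 => [].
- by move=> [i j]; have [_ _] := Hkt (i, j).
Qed.

Lemma box_count_lower : 8 * M ^+ 3 / l ^+ n <= d' - c' ->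
  2 * M ^+ 2 / (l * be) ^+ n <= e ->
  (d' - c') * e / 16 * (l ^+ 2 * be) ^+ n <=
  (box_count (graph_on f a b) d)%:R * M ^+ 5.
Proof.
move=> h1 h2; apply: (@le_trans _ _ ((Nw * K)%:R * M ^+ 5)); last first.
  by rewrite ler_pM2r ?exprn_gt0// ler_nat; exact: box_count_ge.
have half (x : R) : 2 <= x -> x / 2 <= (Num.truncn x)%:R.
  move=> x2; have /andP[_] : (Num.truncn x)%:R <= x < (Num.truncn x).+1%:R.
    by apply: truncn_itv; lra.
  by rewrite -natr1; lra.
have N_ge : (d' - c') * l ^+ n / (8 * M ^+ 3) <= Nw%:R.
  have -> : (d' - c') * l ^+ n / (8 * M ^+ 3) = (d' - c') / w / 2.
    by rewrite /w; field; rewrite !gt_eqF.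
  by apply: half; rewrite ler_pdivlMr// mulrA; apply: le_trans h1; rewrite /w; lra.
have K_ge : e * (l * be) ^+ n / (2 * M ^+ 2) <= K%:R.
  have dV : l ^+ n <= d^-1 by rewrite -[leLHS]invrK lef_pV2 ?posrE ?invr_gt0.
  have lbn : 0 < (l * be) ^+ n by rewrite exprn_gt0// mulr_gt0.
  have base : e * (l * be) ^+ n / M ^+ 2 <= e * be ^+ n / M ^+ 2 / d.
    have -> : e * (l * be) ^+ n / M ^+ 2 = e * be ^+ n / M ^+ 2 * l ^+ n.
      by rewrite exprMn; ring.
    by rewrite ler_pM2l// !divr_gt0 ?mulr_gt0 ?exprn_gt0.
  apply: (@le_trans _ _ (e * be ^+ n / M ^+ 2 / d / 2)).
    have -> : e * (l * be) ^+ n / (2 * M ^+ 2) = e * (l * be) ^+ n / M ^+ 2 / 2.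
      by field; rewrite gt_eqF.
    by rewrite ler_pM2r// invr_gt0.
  apply: half; apply: le_trans base.
  by rewrite ler_pdivlMr ?exprn_gt0// -ler_pdivrMr.
rewrite natrM.
have -> : (d' - c') * e / 16 * (l ^+ 2 * be) ^+ n =
  ((d' - c') * l ^+ n / (8 * M ^+ 3)) * (e * (l * be) ^+ n / (2 * M ^+ 2)) * M ^+ 5.
  have -> : (l ^+ 2 * be) ^+ n = l ^+ n * (l * be) ^+ n by rewrite -exprMn mulrA -expr2.
  by field; rewrite gt_eqF.
rewrite ler_pM2r ?exprn_gt0//; apply: ler_pM => //.
  by rewrite divr_ge0 ?mulr_ge0 ?subr_ge0 ?exprn_ge0 ?ltW.
by rewrite divr_ge0 ?mulr_ge0 ?exprn_ge0 ?mulr_ge0 ?ltW.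
Qed.

End Lower.
End Scale.

Lemma holder_continuous : continuous f.
Proof.
move=> x; apply/cvgrPdist_le => e e0.
have [k K] := poly_geometric_small 0 be01 (divr_gt0 e0 C0).
apply/nbhs_ballP; exists (2 / l ^+ k) => [|t xt] /=; first by rewrite divr_gt0.
apply: (le_trans (f_holder (n := k) _)); first exact: ltW xt.
by have := K k (leqnn k); rewrite expr0 mul1r ler_pdivlMr// mulrC.
Qed.

Variables (c' d' e : R) (n1 : nat).
Hypothesis ac' : a <= c'.
Hypothesis d'b : d' <= b.
Hypothesis cd' : c' < d'.
Hypothesis e0 : 0 < e.
Hypothesis osc : forall n, (n1 <= n)%N -> forall t0, c' <= t0 <= d' -> exists t t',
    [/\ t0 <= t <= t0 + n.+1%:R ^+ 3 * (2 / l ^+ n),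
        t0 <= t' <= t0 + n.+1%:R ^+ 3 * (2 / l ^+ n) &
        e * be ^+ n <= `|f t - f t'| * n.+1%:R ^+ 2].

Let N (d : R) : R := (box_count (graph_on f a b) d)%:R.

Let box_count_bounds : exists (A B : R) (n2 : nat), [/\ 0 < A, 0 < B &
  forall n d, (n2 <= n)%N -> (l ^+ n.+1)^-1 < d <= (l ^+ n)^-1 ->
  A * (l ^+ 2 * be) ^+ n <= N d * n.+1%:R ^+ 5 /\ N d <= B * (l ^+ 2 * be) ^+ n].
Proof.
have lV : 0 < l^-1 < 1 by rewrite invr_gt0 l0 invf_lt1.
have lbV : 0 < (l * be)^-1 < 1.
  by rewrite invr_gt0 (lt_trans _ lbe)// invf_lt1// (lt_trans _ lbe).
have e1 : 0 < (d' - c') / 8 by rewrite divr_gt0// subr_gt0.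
have [k1 K1] := poly_geometric_small 3 lV e1.
have [k2 K2] := poly_geometric_small 2 lbV (divr_gt0 e0 (ltr0Sn R 1)).
exists ((d' - c') * e / 16), ((b - a + 3) * l * (2 * C + 3) * l).
exists (maxn n1 (maxn k1 k2)); split.
- by rewrite divr_gt0// mulr_gt0// subr_gt0.
- have := ab; have := C0 => ? ?.
  by rewrite !mulr_gt0//; lra.
move=> n d; rewrite !geq_max => /and3P[n1n k1n k2n] /andP[d_gt d_le].
have d0 : 0 < d by apply: lt_trans d_gt; rewrite invr_gt0.
split; last exact: box_count_le.
apply: (@box_count_lower n d d0 d_le) => //.
- exact: holder_continuous.
- exact: osc.
- by have := K1 n k1n; rewrite exprVn; lra.
- by have := K2 n k2n; rewrite exprVn; lra.
Qed.

Lemma has_box_dim_graph : has_box_dim (graph_on f a b) (2 + ln be / ln l).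
Proof.
set D := 2 + ln be / ln l.
have [A [B [n2 [A0 B0 bounds]]]] := box_count_bounds.
have L0 : 0 < ln l by rewrite ln_gt0.
pose G := l ^+ 2 * be.
have G1 : 1 < G.
  by rewrite /G expr2 -mulrA -[ltLHS]mulr1; apply: ltr_pM.
have G0 : 0 < G := lt_trans ltr01 G1.
have DL : D * ln l = ln G.
  by rewrite /G lnM ?posrE ?exprn_gt0// lnXn// /D mulrDl divfK ?gt_eqF// mulr_natl.
have lnG0 : 0 < ln G by rewrite ln_gt0.
have D0 : 0 < D by rewrite -(pmulr_lgt0 _ L0) DL.
suff near (eps : R) : 0 < eps -> \forall d \near (0 : R)^'+,
    ((D - eps)%:E <= box_ratio (graph_on f a b) d <= (D + eps)%:E)%E.
  by rewrite /has_box_dim /upper_box_dim /lower_box_dim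
    (limf_esup_squeeze _ near) (limf_einf_squeeze _ near).
move=> eps0.
have zE : 0 < expR (- (eps * ln l / 2)) < 1.
  by rewrite expR_gt0 -expR0 ltr_expR oppr_lt0 divr_gt0// mulr_gt0.
have [k3 K3] := poly_geometric_small 5 zE (ltr01 : 0 < 1 :> R).
pose Y := (maxn n2 k3)%:R * ln l + `|ln B| / eps + 2 * (ln G + `|ln A|) / eps + 1.
have p1 : 0 <= (maxn n2 k3)%:R * ln l by rewrite mulr_ge0// ltW.
have p2 : 0 <= `|ln B| / eps by rewrite divr_ge0// ltW.
have p3 : 0 <= 2 * (ln G + `|ln A|) / eps.
  by rewrite divr_ge0 ?mulr_ge0 ?addr_ge0// ltW.
have [YB YA Yn Y1] : [/\ `|ln B| / eps <= Y, 2 * (ln G + `|ln A|) / eps <= Y,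
    (maxn n2 k3)%:R * ln l <= Y & 1 <= Y].
  exact: summands_le.
near=> d.
have d0 : 0 < d by near: d; exact: nbhs_right_gt.
have dY : d < expR (- Y) by near: d; apply: nbhs_right_lt; exact: expR_gt0.
have d1 : 0 < 1 / d by rewrite divr_gt0.
pose y := ln (1 / d).
have yY : Y < y.
  by rewrite /y div1r lnV ?posrE// ltrNr -ltr_expR lnK.
have y0 : 0 < y by apply: lt_trans yY; exact: lt_le_trans Y1.
have /andP[ny yn] := truncn_itv (ltW (divr_gt0 y0 L0)).
set n := Num.truncn (y / ln l) in ny yn.
rewrite ler_pdivlMr// in ny; rewrite ltr_pdivrMr// in yn.
have nn : (maxn n2 k3 <= n)%N.
  rewrite -ltnS -(ltr_nat R) -(ltr_pM2r L0); apply: lt_trans yn.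
  exact: le_lt_trans yY.
move: nn; rewrite geq_max => /andP[n2n k3n].
have ld : l ^+ n <= 1 / d.
  by rewrite -ler_ln ?posrE// lnXn// -mulr_natl.
have dl : 1 / d < l ^+ n.+1.
  by rewrite -ltr_ln ?posrE// lnXn// -mulr_natl.
have [|lo hi] := bounds n d n2n.
  rewrite -[d in _ < d](invrK d) -[d in d <= _](invrK d) ltf_pV2 ?posrE ?invr_gt0//.
  by rewrite lef_pV2 ?posrE ?invr_gt0// -div1r ld dl.
rewrite -/G in lo hi.
set M : R := n.+1%:R in lo; have M0 : 0 < M by rewrite ltr0n.
have Gn : 0 < G ^+ n by rewrite exprn_gt0.
have M5 : 0 < M ^+ 5 by rewrite exprn_gt0.
have N0 : 0 < N d.
  by rewrite -(pmulr_lgt0 _ M5); apply: lt_le_trans lo; rewrite mulr_gt0.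
have lnN_le : ln (N d) <= ln B + n%:R * ln G.
  by rewrite mulr_natl -lnXn// -lnM ?posrE// ler_ln ?posrE// mulr_gt0.
have lnN_ge : ln A + n%:R * ln G <= ln (N d) + ln (M ^+ 5).
  by rewrite mulr_natl -lnXn// -!lnM ?posrE// ler_ln ?posrE ?mulr_gt0.
have lnM_le : ln (M ^+ 5) <= n%:R * (eps * ln l / 2).
  have := K3 n k3n; rewrite -/M -expRM_natl mulrN expRN ler_pdivrMr ?expR_gt0// mul1r => h.
  by rewrite -[leRHS]expRK ler_ln ?posrE ?expR_gt0.
have h1 : `|ln B| <= y * eps by rewrite -ler_pdivrMr//; exact: le_trans (ltW yY).
have h2 : 2 * (ln G + `|ln A|) <= y * eps.
  by rewrite -ler_pdivrMr//; exact: le_trans (ltW yY).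
have Dy1 : n%:R * ln G <= D * y.
  by rewrite -DL mulrCA ler_pM2l.
have Dy2 : D * y <= (n%:R + 1) * ln G.
  by rewrite -DL mulrCA ler_pM2l// natr1 ltW.
have nel : n%:R * (eps * ln l / 2) <= eps * y / 2.
  have -> : n%:R * (eps * ln l / 2) = eps * (n%:R * ln l) / 2 by ring.
  by rewrite ler_pM2r ?invr_gt0// ler_pM2l.
rewrite /box_ratio !lee_fin -/(N d) -/y ler_pdivlMr// ler_pdivrMr//.
exact: (log_count_squeeze lnN_le lnN_ge lnM_le h1 h2 Dy1 Dy2 nel).
Unshelve. all: by end_near. Qed.
End BoxCounting.

(** * Lower bounds for sin (q^n x) at almost every x *)

Section SmallSines.
Variable R : realType.
Implicit Types (rho x z : R).

Lemma sin_ge_linear rho : 0 <= rho <= 1 -> cos 1 * rho <= sin rho.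
Proof.
move=> /andP[r0 r1]; have p1 := @pihalf_ge1 R.
have [|c] := @MVT_segment R sin cos 0 rho r0.
  by apply: continuous_subspaceT => w; exact: continuous_sin.
rewrite in_itv /= sin0 !subr0 => /andP[c0 cr] ->; apply: ler_wpM2r => //.
have := le_trans cr r1; rewrite le_eqVlt => /predU1P[->//|c1].
by apply: ltW; rewrite ltr_cos ?in_itv /=; lra.
Qed.

Lemma sin_ge_away_from_zeros rho z : 0 <= rho <= 1 -> rho <= z <= pi - rho ->
  cos 1 * rho <= sin z.
Proof.
move=> r01; have /andP[r0 r1] := r01; have p1 := @pihalf_ge1 R.
have mono w : rho <= w <= pi / 2 -> cos 1 * rho <= sin w.
  move=> /andP[rw wp]; apply: (le_trans (sin_ge_linear r01)).
  move: rw; rewrite le_eqVlt => /predU1P[->//|rw].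
  by apply: ltW; rewrite ltr_sin ?in_itv /=; lra.
move=> /andP[rz zr]; have [zp|/ltW zp] := leP z (pi / 2); first by apply: mono; rewrite rz.
have -> : sin z = sin (pi - z) by rewrite sinB sinpi cospi; ring.
by apply: mono; apply/andP; split; lra.
Qed.

Variable q : nat.
Hypothesis q1 : (1 <= q)%N.

Let Q n : R := (q ^ n)%:R.
Let Q1 n : 1 <= Q n. Proof. by rewrite ler1n expn_gt0 q1. Qed.
Let Q0 n : 0 < Q n. Proof. exact: lt_le_trans (Q1 n). Qed.
Let rho n : R := n.+1%:R ^- 2.
Let rho0 n : 0 < rho n. Proof. by rewrite invr_gt0 exprn_gt0. Qed.
Let rho1 n : rho n <= 1.
Proof. by rewrite invf_le1 ?exprn_gt0// exprn_ege1// ler1n. Qed.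

(* The zeros k pi / q^n are taken up to k = q^n + 1, so that every point of [0, pi] lies between
   two consecutive ones. *)
Let zone n k : set (measurableTypeR R) := ball (k%:R * pi / Q n) (rho n / Q n).
Let bad n : set (measurableTypeR R) := \big[setU/set0]_(k < (q ^ n).+2) zone n k.

Let mzone n k : measurable (zone n k). Proof. exact: measurable_ball. Qed.
Let mbad n : measurable (bad n). Proof. exact: bigsetU_measurable. Qed.

Let bad_le n : (lebesgue_measure (bad n) <= (6 * rho n)%:E)%E.
Proof.
have r0 : 0 <= rho n / Q n by rewrite divr_ge0 ?ltW.
apply: (le_trans (Boole_inequality _ _)) => //.
rewrite (eq_bigr (fun=> (rho n / Q n *+ 2)%:E)); last first.
  by move=> k _; exact: lebesgue_measure_ball.
rewrite sumEFin lee_fin sumr_const card_ord -mulrnA -[leLHS]mulr_natl natrM.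
have -> : (q ^ n).+2%:R = Q n + 2 :> R by rewrite -addn2 natrD.
have -> : 2%:R * (Q n + 2) * (rho n / Q n) = 2 * rho n + 4 * (rho n / Q n).
  by move: (Q n) (Q0 n) (rho n) => Z Z0 r; field; rewrite gt_eqF.
have : rho n / Q n <= rho n by rewrite ler_pdivrMr// ler_peMr// ltW.
by lra.
Qed.

Let sum_rho N : \sum_(n < N.+1) rho n <= 2 - N.+1%:R^-1.
Proof.
elim: N => [|N IH]; first by rewrite big_ord_recl big_ord0 addr0 /rho expr1n invr1; lra.
rewrite big_ord_recr /=; apply: (le_trans (lerD IH (lexx _))).
rewrite /rho -subr_ge0 -[N.+2%:R]natr1; set M : R := N.+1%:R.
have M0 : 0 < M by rewrite ltr0n.
have -> : 2 - (M + 1)^-1 - (2 - M^-1 + (M + 1) ^- 2) = (M * (M + 1) ^+ 2)^-1.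
  by field; rewrite !gt_eqF// addr_gt0.
by rewrite invr_ge0 mulr_ge0 ?exprn_ge0 ?addr_ge0 ?ltW.
Qed.

Let negligible_bad : lebesgue_measure (lim_sup_set bad) = 0%E.
Proof.
apply: lim_sup_set_cvg0 => //.
apply: (@le_lt_trans _ _ (12 : R)%:E); last exact: ltry.
apply: lime_le; first by apply: is_cvg_nneseries => n _ _.
apply: nearW => N; rewrite big_mkord.
apply: (@le_trans _ _ (\sum_(n < N) (6 * rho n)%:E)%E); first by apply: lee_sum => n _; exact: bad_le.
rewrite sumEFin lee_fin -mulr_sumr.
case: N => [|N]; first by rewrite big_ord0 mulr0.
have S2 : \sum_(n < N.+1) rho n <= 2 by apply: (le_trans (sum_rho N)); rewrite gerBl invr_ge0.
by apply: (le_trans (ler_wpM2l _ S2)) => //; rewrite -natrM.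
Qed.

Let sin_ge_notbad n x : 0 <= x <= pi -> ~ bad n x ->
  cos 1 <= `|sin (q%:R ^+ n * x)| * n.+1%:R ^+ 2.
Proof.
move=> /andP[x0 xpi] nb; rewrite -natrX -/(Q n); set y := Q n * x.
have p0 := pi_gt0 R; have Qn := Q0 n.
have y0 : 0 <= y by rewrite mulr_ge0// ltW.
have /andP[ky yk] := truncn_itv (divr_ge0 y0 (pi_ge0 R)).
set k := Num.truncn (y / pi) in ky yk.
rewrite ler_pdivlMr// in ky; rewrite ltr_pdivrMr// in yk.
have kQ : (k <= q ^ n)%N.
  rewrite -(ler_nat R) -(ler_pM2r p0); apply: (le_trans ky).
  by rewrite /y ler_pM2l.
have far j : (j < (q ^ n).+2)%N -> rho n <= `|y - j%:R * pi|.
  move=> jq; rewrite leNgt; apply/negP => lt; apply: nb.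
  rewrite /bad -bigcup_mkord; exists j => //; rewrite /zone /ball /=.
  have -> : j%:R * pi / Q n - x = (j%:R * pi - y) / Q n.
    by rewrite /y; field; rewrite gt_eqF.
  by rewrite normrM normfV (gtr0_norm Qn) ltr_pM2r ?invr_gt0// distrC.
pose z := y - k%:R * pi.
have zE : y = z + pi *+ k by rewrite /z -[pi *+ k]mulr_natl subrK.
have z1 : rho n <= z.
  by have := far k (leqW kQ); rewrite ger0_norm// subr_ge0.
have z2 : z <= pi - rho n.
  have := far k.+1 kQ; rewrite distrC ger0_norm ?subr_ge0 ?(ltW yk)//.
  by rewrite /z -natr1; lra.
rewrite zE (alternatingn (@sinDpi R)) normrM normrX normrN1 expr1n mul1r.
rewrite -ler_pdivrMr ?exprn_gt0//.
apply: (le_trans _ (ler_norm _)); apply: sin_ge_away_from_zeros; last by rewrite z1.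
by rewrite rho1 ltW.
Qed.

Lemma ae_sin_lower_bound : {ae (@lebesgue_measure R), forall x : R, x \in `[0, pi] ->
  exists n0, forall n, (n0 <= n)%N -> cos 1 <= `|sin (q%:R ^+ n * x)| * n.+1%:R ^+ 2}.
Proof.
exists (lim_sup_set bad); split => //.
  by apply: bigcap_measurable => // k _; apply: bigcup_measurable.
move=> x /= nx N _; apply: contrapT => nb; apply: nx => xpi; exists N => n Nn.
move: xpi; rewrite in_itv /= => xpi; apply: sin_ge_notbad => // bx; apply: nb.
by exists n.
Qed.

End SmallSines.

Section Wavefunction.
Variables (R : realType) (q : nat) (s x : R).
Hypothesis q2 : (2 <= q)%N.
Hypothesis s02 : 0 < s < 2.

Let be : R := q%:R `^ (s - 2).
Let amp k : R := be ^+ k * sin (q%:R ^+ k * x).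

Let s0 : 0 < s. Proof. by case/andP: s02. Qed.
Let s2 : s < 2. Proof. by case/andP: s02. Qed.
Let lnq0 : 0 < ln (q%:R : R). Proof. by rewrite ln_gt0// ltr1n. Qed.
Let be0 : 0 < be. Proof. by rewrite powR_gt0// ltr0n ltnW. Qed.
Let ln_be : ln be = (s - 2) * ln q%:R. Proof. exact: ln_powR. Qed.
Let ln_sqr : ln ((q ^ 2)%:R : R) = 2 * ln q%:R.
Proof. by rewrite natrX lnXn ?ltr0n 1?ltnW// mulr_natl. Qed.

Let be1 : be < 1.
Proof. by rewrite -ltr_ln ?posrE// ln1 ln_be nmulr_rlt0// subr_lt0. Qed.
Let be01 : 0 < be < 1. Proof. by rewrite be0 be1. Qed.

Let q40 : 0 < (q ^ 2)%:R :> R. Proof. by rewrite ltr0n expn_gt0 ltnW. Qed.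
Let lbe : 1 < (q ^ 2)%:R * be.
Proof.
rewrite -ltr_ln ?posrE ?mulr_gt0// ln1 lnM ?posrE// ln_be ln_sqr -mulrDl.
by rewrite addrC subrK mulr_gt0.
Qed.

Let m4 : (4 <= q ^ 2)%N. Proof. by rewrite -[4%N]/(2 ^ 2)%N leq_exp2r. Qed.

Let amp_le k : `|amp k| <= be ^+ k.
Proof.
by rewrite normrM normrX (gtr0_norm be0) ler_piMr ?sin_max// exprn_ge0// ltW.
Qed.

Let coefE k : coef q s k = be ^+ k.
Proof. by rewrite /coef mulrC powRrM powR_mulrn// ltW. Qed.

Let Nconst_gt0 : 0 < Nconst q s.
Proof.
rewrite sqrtr_gt0 mulr_gt0 ?divr_gt0 ?pi_gt0// subr_gt0 mulrC powRrM powR_mulrn ?ltW//.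
by rewrite exprn_ilt1// ltW.
Qed.

Let lacunaryE phi t : limn (series (fun n => coef q s n * sin (q%:R ^+ n * x) *
  phi (q%:R ^+ (2 * n) * t))) = lacunary (q ^ 2) amp phi t.
Proof.
rewrite /lacunary; congr (limn (series _)); apply/funext => k.
by rewrite coefE natrX -exprM.
Qed.

Lemma PdensE t : Pdens q s x t = Nconst q s ^+ 2 * intensity (q ^ 2) amp t.
Proof. by rewrite /Pdens /RePsi /ImPsi !lacunaryE sqrrN !exprMn -mulrDr. Qed.

Lemma Pdens_has_box_dim (kappa : R) (n0 : nat) : 0 < kappa ->
  (forall n, (n0 <= n)%N -> kappa <= `|sin (q%:R ^+ n * x)| * n.+1%:R ^+ 2) ->
  forall a b, a < b ->
  has_box_dim (graph_on (fun t => Pdens q s x t) a b) (1 + s / 2).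
Proof.
move=> kappa0 sin_ge a b ab.
have amp_ge n : (n0 <= n)%N -> kappa * be ^+ n <= `|amp n| * n.+1%:R ^+ 2.
  move=> /sin_ge h; rewrite normrM normrX (gtr0_norm be0) mulrC -mulrA.
  by rewrite ler_pM2l// exprn_gt0.
have [c [d [e [n1 [ac cd db e0 osc]]]]] :=
  intensity_oscillation m4 be01 lbe amp_le kappa0 amp_ge ab.
have N2 : 0 < Nconst q s ^+ 2 by rewrite exprn_gt0.
have H0 := holder_const_gt0 be01 lbe.
have -> : 1 + s / 2 = 2 + ln be / ln (q ^ 2)%:R.
  by rewrite ln_be ln_sqr; field; rewrite gt_eqF.
pose C := Nconst q s ^+ 2 * (4 / (1 - be) * holder_const (q ^ 2) be).
have C0 : 0 < C by rewrite !mulr_gt0// invr_gt0 subr_gt0.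
apply: (@has_box_dim_graph R _ be _ a b m4 be01 lbe ab C C0 _ c d
  (Nconst q s ^+ 2 * e) n1) => //.
- move=> n t t' /(intensity_holder m4 be01 lbe amp_le) h.
  by rewrite /C !PdensE -mulrBr normrM (gtr0_norm N2) -[leRHS]mulrA ler_pM2l.
- by rewrite mulr_gt0.
- move=> n /osc{}osc t0 /osc[t [t' [h1 h2 h3]]]; exists t, t'; split => //.
  by rewrite !PdensE -mulrBr normrM (gtr0_norm N2) -[leLHS]mulrA -[leRHS]mulrA ler_pM2l.
Qed.

End Wavefunction.

Theorem theorem1 (R : realType) (q : nat) (s : R) :
  (2 <= q)%N -> 0 < s < 2 ->
  {ae (@lebesgue_measure R), forall x : R, x \in `[0, pi] ->
     forall a b : R, a < b ->
       has_box_dim (graph_on (fun t => Pdens q s x t) a b) (1 + s / 2)}.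
Proof.
move=> q2 s02; apply: negligibleS (ae_sin_lower_bound R (ltnW q2)) => x /= nP sin_ge.
apply: nP => xpi; have [n0 {}sin_ge] := sin_ge xpi.
exact: (Pdens_has_box_dim q2 s02 (cos1_gt0 R) sin_ge).
Qed.
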